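(* Let $\mathcal L$ be a 2-di-exact 2-category. Consider 1-cells $$A\xrightarrow{a}B\xrightarrow{b}C\to 0\quad\text{(top row)},\qquad 0\to X\xrightarrow{c}Y\xrightarrow{d}Z\quad\text{(bottom row)},$$ and vertical 1-cells $f\colon A\to X$, $g\colon B\to Y$, $h\colon C\to Z$, together with invertible 2-cells $\phi\colon g\circ a\cong c\circ f$ and $\psi\colon h\circ b\cong d\circ g$. Assume that $f$, $g$ and $h$ are normal and that both rows are 2-exact. Then there exists a 1-cell $\partial\colon \mathrm{Ker}(h)\to\mathrm{Cok}(f)$ such that the sequence $$\mathrm{Ker}(f)\xrightarrow{\bar a}\mathrm{Ker}(g)\xrightarrow{\bar b}\mathrm{Ker}(h)\xrightarrow{\partial}\mathrm{Cok}(f)\xrightarrow{\underline c}\mathrm{Cok}(g)\xrightarrow{\underline d}\mathrm{Cok}(h)$$ is 2-exact, where $\bar a,\bar b$ are induced by taking 2-kernels (so $\ker(g)\circ\bar a\cong a\circ\ker(f)$ and $\ker(h)\circ\bar b\cong b\circ\ker(g)$) and $\underline c,\underline d$ are induced by taking 2-cokernels (so $\underline c\circ\operatorname{coker}(f)\cong\operatorname{coker}(g)\circ c$ and $\underline d\circ\operatorname{coker}(g)\cong\operatorname{coker}(h)\circ d$). If, moreover, $a$ is a 2-kernel of $b$, then $\bar a$ is a 2-kernel of $\bar b$; dually, if $d$ is a 2-cokernel of $c$, then $\underline d$ is a 2-cokernel of $\underline c$.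
   Context: 2-categories are strict; 1-cells are also called morphisms. For 1-cells, $\cong$ means that there is an invertible 2-cell between them. Whiskering is denoted $\star$. A bizero object of a 2-category $\mathcal L$ is an object $0$ such that for every object $A$ the hom-categories $\mathcal L(A,0)$ and $\mathcal L(0,A)$ are equivalent to the terminal category. A 1-cell is null if it factors through $0$; $f\cong 0$ means that $f$ is isomorphic to a null 1-cell. The bizero object is strong if between any two parallel 1-cells that factor through $0$ there is exactly one 2-cell. In a 2-category with a strong bizero object, a 2-kernel of $f\colon A\to B$ is a 1-cell $k\colon K\to A$ with an invertible 2-cell $f\circ k\cong 0$ such that (1) for every $z\colon Z\to A$ with $f\circ z\cong0$ there is $u\colon Z\to K$ with $k\circ u\cong z$; (2) for all $u,v\colon Z\to K$ and every 2-cell $\lambda\colon k\circ u\Rightarrow k\circ v$ there is a unique 2-cell $\mu\colon u\Rightarrow v$ with $k\star\mu=\lambda$. 2-cokernels are defined dually (reversing 1-cells). They are unique up to equivalence and are written $\ker(f)\colon\mathrm{Ker}(f)\to A$ and $\operatorname{coker}(f)\colon B\to\mathrm{Cok}(f)$. A normal 2-monomorphism is a 1-cell which is a 2-kernel of some 1-cell; a normal 2-epimorphism is a 1-cell which is a 2-cokernel of some 1-cell. A 1-cell is normal if it is isomorphic to $m\circ e$ with $e$ a normal 2-epimorphism and $m$ a normal 2-monomorphism; this factorisation is unique up to equivalence, and one writes $m=\mathrm{im}(f)$, $e=\mathrm{coim}(f)$. A 1-cell is antinormal if it is isomorphic to $e\circ m$ with $m$ a normal 2-monomorphism and $e$ a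 normal 2-epimorphism. A 2-category with a strong bizero object is 2-di-exact if (DI1) it has all 2-kernels and all 2-cokernels, and (DI2) every antinormal 1-cell is normal. A composable pair $(f,g)$ of normal 1-cells $A\xrightarrow{f}B\xrightarrow{g}C$ is 2-exact in $B$ if $\mathrm{im}(f)$ is a 2-kernel of $g$ (equivalently, $\mathrm{coim}(g)$ is a 2-cokernel of $f$). A sequence of 1-cells is 2-exact if all its 1-cells are normal and it is 2-exact at every position where the condition makes sense (i.e. at every object having both an incoming and an outgoing 1-cell in the sequence). *)

(* Defs.v *)
Set Implicit Arguments.
Unset Strict Implicit.
Unset Printing Implicit Defensive.

Declare Scope twocat_scope.
Delimit Scope twocat_scope with twocat.
Open Scope twocat_scope.

Record Category := {
  obj :> Type;
  arr : obj -> obj -> Type;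
  idar : forall x, arr x x;
  vcomp : forall x y z, arr y z -> arr x y -> arr x z;
  vcompA : forall x y z t (c : arr z t) (b : arr y z) (a : arr x y),
    vcomp c (vcomp b a) = vcomp (vcomp c b) a;
  vcomp_idl : forall x y (a : arr x y), vcomp (idar y) a = a;
  vcomp_idr : forall x y (a : arr x y), vcomp a (idar x) = a
}.
Arguments arr {_} _ _.
Arguments idar {_} _.

Notation "x ⇒ y" := (arr x y) (at level 70) : twocat_scope.
Notation "b • a" := (vcomp b a) (at level 40, left associativity) : twocat_scope.

Definition invertible (C : Category) (x y : C) (a : x ⇒ y) : Prop :=
  exists b : y ⇒ x, b • a = idar x /\ a • b = idar y.

Definition isomorphic (C : Category) (x y : C) : Prop :=
  exists a : x ⇒ y, invertible a.

Notation "x ≅ y" := (isomorphic x y) (at level 70) : twocat_scope.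

Record Functor (C D : Category) := {
  fobj :> C -> D;
  fmap : forall x y : C, x ⇒ y -> fobj x ⇒ fobj y;
  fmap_id : forall x, fmap (idar x) = idar (fobj x);
  fmap_comp : forall (x y z : C) (b : y ⇒ z) (a : x ⇒ y),
    fmap (b • a) = fmap b • fmap a
}.

Definition id_functor (C : Category) : Functor C C.
Proof.
exact (@Build_Functor C C (fun x => x) (fun x y a => a)
  (fun x => eq_refl) (fun x y z b a => eq_refl)).
Defined.

Definition comp_functor (C D E : Category) (G : Functor D E) (F : Functor C D) :
  Functor C E.
Proof.
refine (@Build_Functor C E (fun x => G (F x))
  (fun x y a => fmap G (fmap F a)) _ _).
- intro x. now rewrite !fmap_id.
- intros x y z b a. now rewrite !fmap_comp.
Defined.

Definition naturally_isomorphic (C D : Category) (F G : Functor C D) : Prop :=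
  exists t : forall x : C, F x ⇒ G x,
    (forall x, invertible (t x)) /\
    (forall (x y : C) (a : x ⇒ y), t y • fmap F a = fmap G a • t x).

Definition equivalent (C D : Category) : Prop :=
  exists (F : Functor C D) (G : Functor D C),
    naturally_isomorphic (comp_functor G F) (id_functor C) /\
    naturally_isomorphic (comp_functor F G) (id_functor D).

Definition terminal_category : Category.
Proof.
refine (@Build_Category unit (fun _ _ => unit) (fun _ => tt)
  (fun _ _ _ _ _ => tt) _ _ _); try reflexivity; now intros ? ? [].
Defined.

Definition cast (C : Category) (x x' y y' : C) (p : x = x') (q : y = y')
    (a : x ⇒ y) : x' ⇒ y' :=
  match p in _ = s, q in _ = t return s ⇒ t with
  | eq_refl, eq_refl => a
  end.

(** [Hom A B] is the category of 1-cells from [A] to [B] and of 2-cells between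
    them; [•] is vertical and [hcomp] horizontal composition.  The unit and
    associativity laws hold strictly on 1-cells, hence on 2-cells up to
    transport along the laws for 1-cells. *)

Record TwoCategory := {
  cell0 :> Type;
  Hom : cell0 -> cell0 -> Category;
  id1 : forall A, Hom A A;
  comp1 : forall A B C, Hom B C -> Hom A B -> Hom A C;
  hcomp : forall A B C (g g' : Hom B C) (f f' : Hom A B),
    g ⇒ g' -> f ⇒ f' -> comp1 g f ⇒ comp1 g' f';
  hcomp_id : forall A B C (g : Hom B C) (f : Hom A B),
    hcomp (idar g) (idar f) = idar (comp1 g f);
  interchange : forall A B C (g g' g'' : Hom B C) (f f' f'' : Hom A B)
      (b' : g' ⇒ g'') (b : g ⇒ g') (a' : f' ⇒ f'') (a : f ⇒ f'),
    hcomp (b' • b) (a' • a) = hcomp b' a' • hcomp b a;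
  comp1A : forall A B C D (h : Hom C D) (g : Hom B C) (f : Hom A B),
    comp1 h (comp1 g f) = comp1 (comp1 h g) f;
  comp1_idl : forall A B (f : Hom A B), comp1 (id1 B) f = f;
  comp1_idr : forall A B (f : Hom A B), comp1 f (id1 A) = f;
  hcompA : forall A B C D (h h' : Hom C D) (g g' : Hom B C) (f f' : Hom A B)
      (c : h ⇒ h') (b : g ⇒ g') (a : f ⇒ f'),
    cast (comp1A h g f) (comp1A h' g' f') (hcomp c (hcomp b a)) =
    hcomp (hcomp c b) a;
  hcomp_idl : forall A B (f f' : Hom A B) (a : f ⇒ f'),
    cast (comp1_idl f) (comp1_idl f') (hcomp (idar (id1 B)) a) = a;
  hcomp_idr : forall A B (f f' : Hom A B) (a : f ⇒ f'),
    cast (comp1_idr f) (comp1_idr f') (hcomp a (idar (id1 A))) = a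
}.
Arguments Hom {_} _ _.

Notation "g ∘ f" := (comp1 g f) (at level 40, left associativity) : twocat_scope.
Notation "k ⋆l a" := (hcomp (idar k) a) (at level 40) : twocat_scope.
Notation "a ⋆r k" := (hcomp a (idar k)) (at level 40) : twocat_scope.

Definition bizero (L : TwoCategory) (O : L) : Prop :=
  forall A : L,
    equivalent (Hom A O) terminal_category /\
    equivalent (Hom O A) terminal_category.

Definition null (L : TwoCategory) (O : L) (A B : L) (f : Hom A B) : Prop :=
  exists (p : Hom A O) (q : Hom O B), f = q ∘ p.

(** [f ≅ 0] *)
Definition iso_null (L : TwoCategory) (O : L) (A B : L) (f : Hom A B) : Prop :=
  exists n : Hom A B, null O n /\ f ≅ n.

Definition strong_bizero (L : TwoCategory) (O : L) : Prop :=
  bizero O /\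
  forall (A B : L) (f g : Hom A B),
    null O f -> null O g -> exists! a : f ⇒ g, True.

(** [is_2kernel O f k] reads "[k] is a 2-kernel of [f]".  The invertible 2-cell
    [f ∘ k ≅ 0] is only required to exist: neither universal property mentions
    it, and it carries no choice because the bizero object is strong. *)

Definition is_2kernel (L : TwoCategory) (O : L) (A B K : L)
    (f : Hom A B) (k : Hom K A) : Prop :=
  iso_null O (f ∘ k) /\
  (forall (Z : L) (z : Hom Z A), iso_null O (f ∘ z) ->
     exists u : Hom Z K, k ∘ u ≅ z) /\
  (forall (Z : L) (u v : Hom Z K) (l : k ∘ u ⇒ k ∘ v),
     exists! m : u ⇒ v, k ⋆l m = l).

Definition is_2cokernel (L : TwoCategory) (O : L) (A B C : L)
    (f : Hom A B) (c : Hom B C) : Prop :=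
  iso_null O (c ∘ f) /\
  (forall (Z : L) (z : Hom B Z), iso_null O (z ∘ f) ->
     exists u : Hom C Z, u ∘ c ≅ z) /\
  (forall (Z : L) (u v : Hom C Z) (l : u ∘ c ⇒ v ∘ c),
     exists! m : u ⇒ v, m ⋆r c = l).

Definition normal_2mono (L : TwoCategory) (O : L) (A B : L) (m : Hom A B) : Prop :=
  exists (C : L) (f : Hom B C), is_2kernel O f m.

Definition normal_2epi (L : TwoCategory) (O : L) (A B : L) (e : Hom A B) : Prop :=
  exists (C : L) (f : Hom C A), is_2cokernel O f e.

(** [m] and [e] are an image and a coimage of [f]. *)
Definition normal_factorisation (L : TwoCategory) (O : L) (A I B : L)
    (f : Hom A B) (m : Hom I B) (e : Hom A I) : Prop :=
  normal_2mono O m /\ normal_2epi O e /\ f ≅ m ∘ e.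

Definition normal (L : TwoCategory) (O : L) (A B : L) (f : Hom A B) : Prop :=
  exists (I : L) (m : Hom I B) (e : Hom A I), normal_factorisation O f m e.

Definition antinormal (L : TwoCategory) (O : L) (A B : L) (f : Hom A B) : Prop :=
  exists (J : L) (e : Hom J B) (m : Hom A J),
    normal_2epi O e /\ normal_2mono O m /\ f ≅ e ∘ m.

Record two_di_exact (L : TwoCategory) (O : L) : Prop := {
  DI_bizero : strong_bizero O;
  DI1_kernel : forall (A B : L) (f : Hom A B),
    exists (K : L) (k : Hom K A), is_2kernel O f k;
  DI1_cokernel : forall (A B : L) (f : Hom A B),
    exists (C : L) (c : Hom B C), is_2cokernel O f c;
  DI2 : forall (A B : L) (f : Hom A B), antinormal O f -> normal O f
}.

(** [im(f)] is a 2-kernel of [g].  The image is unique up to equivalence, so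
    the condition does not depend on the normal factorisation chosen. *)
Definition exact_pair (L : TwoCategory) (O : L) (A B C : L)
    (f : Hom A B) (g : Hom B C) : Prop :=
  exists (I : L) (m : Hom I B) (e : Hom A I),
    normal_factorisation O f m e /\ is_2kernel O g m.

(** Nonempty sequences of composable 1-cells from [A] to [Z], with [A] given
    by the index. *)
Inductive sequence (L : TwoCategory) (Z : L) : L -> Type :=
| seq_last : forall A : L, Hom A Z -> sequence Z A
| seq_cons : forall A B : L, Hom A B -> sequence Z B -> sequence Z A.

Notation "f ▷ s" := (seq_cons f s) (at level 60, right associativity) : twocat_scope.

Definition head_target (L : TwoCategory) (Z A : L) (s : sequence Z A) : L :=
  match s with @seq_last _ _ _ _ => Z | @seq_cons _ _ _ B _ _ => B end.

Definition head_cell (L : TwoCategory) (Z A : L) (s : sequence Z A) :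
    Hom A (head_target s) :=
  match s in sequence _ A return Hom A (head_target s) with
  | seq_last f => f
  | seq_cons f _ => f
  end.

Fixpoint exact_sequence (L : TwoCategory) (O : L) (Z A : L) (s : sequence Z A) :
    Prop :=
  match s with
  | seq_last f => normal O f
  | seq_cons f s' =>
      normal O f /\ exact_pair O f (head_cell s') /\ exact_sequence O s'
  end.

(* Main.v *)
From Stdlib Require Import Setoid Morphisms.
Require Import Defs.

Set Implicit Arguments.
Unset Strict Implicit.
Unset Printing Implicit Defensive.

(** The theorem is a statement of ordinary category theory in disguise.
    Identifying isomorphic 1-cells of [L] gives a category with zero morphisms,
    the homotopy category.  A 2-kernel becomes a kernel there, since a fully
    faithful 1-cell becomes a monomorphism.  Conversely a morphism which is a
    kernel in the homotopy category differs from a 2-kernel, which exists by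
    (DI1), by an equivalence, so it is itself a 2-kernel: [two_kernel_iff] and
    [two_cokernel_iff].  Hence normality and exactness can be tested in the
    homotopy category, in which kernels and cokernels exist and antinormal
    morphisms are normal; the theorem is the snake lemma for such di-exact
    categories, [snake].

    Exactness at [Ker g] rests on [kernel_image_normal_epi]: if [f = f1 ∘ e] is
    normal and [e] is a normal epimorphism, then the induced [Ker f → Ker f1] is
    a normal epimorphism.  Taking for [e] the coimage of [a], one sees that
    [Ker f → Ker g] is a normal epimorphism followed by the kernel of
    [Ker g → Ker h].

    For the connecting morphism, let [G] be the image of [g].  Let [N] be the
    subobject [X ∩ G] of [G], and [M] the quotient of [G] by the image of [A].
    The antinormal composite [N → G → M] is normal, with image [W] say.  A
    morphism into [N] is killed by [N → G → M] exactly when it is killed by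
    [N → X → Cok f], because the image of [A] in [G] and the image of [f] in [X]
    are the same subobject of [Y].  Therefore [W] is the kernel of
    [Cok f → Cok g] ([kernel_induced_cokernels]) and, dually, the cokernel of
    [Ker g → Ker h] ([cokernel_induced_kernels]).  The connecting morphism is
    the composite [Ker h → W → Cok f]. *)

(** * Categories with zero morphisms *)

(** The morphisms form setoids, the intended example being 1-cells up to
    isomorphism.  Zero morphisms are given by a predicate: a chosen zero
    morphism between any two objects is not needed, nor is a zero object. *)
Record zero_category := {
  ob :> Type;
  mor : ob -> ob -> Type;
  eqv : forall A B, mor A B -> mor A B -> Prop;
  idm : forall A, mor A A;
  comp : forall A B C, mor B C -> mor A B -> mor A C;
  zero : forall A B, mor A B -> Prop;
  eqv_equivalence : forall A B, Equivalence (@eqv A B);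
  comp_eqv : forall A B C (g g' : mor B C) (f f' : mor A B),
    eqv g g' -> eqv f f' -> eqv (comp g f) (comp g' f');
  compA : forall A B C D (h : mor C D) (g : mor B C) (f : mor A B),
    eqv (comp (comp h g) f) (comp h (comp g f));
  comp_idl : forall A B (f : mor A B), eqv (comp (idm B) f) f;
  comp_idr : forall A B (f : mor A B), eqv (comp f (idm A)) f;
  zero_eqv : forall A B (f g : mor A B), eqv f g -> zero f -> zero g;
  zero_unique : forall A B (f g : mor A B), zero f -> zero g -> eqv f g;
  zero_exists : forall A B, exists f : mor A B, zero f;
  zero_compl : forall A B C (g : mor B C) (f : mor A B),
    zero g -> zero (comp g f);
  zero_compr : forall A B C (g : mor B C) (f : mor A B),
    zero f -> zero (comp g f)
}.

Notation "g ⊙ f" := (comp g f) (at level 40, left associativity) : twocat_scope.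
Notation "f ≃ g" := (eqv f g) (at level 70) : twocat_scope.

#[global] Existing Instance eqv_equivalence.

#[global] Instance comp_proper (C : zero_category) (A B D : C) :
  Proper (@eqv C B D ==> @eqv C A B ==> @eqv C A D) (@comp C A B D).
Proof. intros g g' Hg f f' Hf. now apply comp_eqv. Qed.

#[global] Instance zero_proper (C : zero_category) (A B : C) :
  Proper (@eqv C A B ==> iff) (@zero C A B).
Proof.
  intros f g H; split; apply zero_eqv; [exact H | now symmetry].
Qed.

(** Reversal of morphisms; [opposite (opposite C)] has the same components as
    [C], and a cokernel in [C] is by conversion a kernel in [opposite C], so
    that dual lemmas need no second proof. *)
Definition opposite (C : zero_category) : zero_category.
Proof.
refine {|
  ob := ob C;
  mor := fun A B => mor B A;
  eqv := fun A B f g => f ≃ g;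
  idm := fun A => idm A;
  comp := fun A B D g f => f ⊙ g;
  zero := fun A B f => zero f |}.
- intros A B D g g' f f' Hg Hf. now apply comp_eqv.
- intros A B D E h g f. symmetry. apply compA.
- intros A B f. apply comp_idr.
- intros A B f. apply comp_idl.
- intros A B f g. apply zero_eqv.
- intros A B f g. apply zero_unique.
- intros A B. apply zero_exists.
- intros A B D g f. apply zero_compr.
- intros A B D g f. apply zero_compl.
Defined.

(** Rewriting with an equation between composites, in the middle of a longer
    composite associated to the right. *)
Lemma comp_eqv_assoc (C : zero_category) (A B D : C) (g : mor B D)
    (f : mor A B) (k : mor A D) (H : g ⊙ f ≃ k) (T : C) (x : mor T A) :
  g ⊙ (f ⊙ x) ≃ k ⊙ x.
Proof. now rewrite <- compA, H. Qed.

(** * Kernels, cokernels and normal morphisms *)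

Definition monic (C : zero_category) (A B : C) (m : mor A B) : Prop :=
  forall (Z : C) (u v : mor Z A), m ⊙ u ≃ m ⊙ v -> u ≃ v.

Definition epic (C : zero_category) (A B : C) (e : mor A B) : Prop :=
  forall (Z : C) (u v : mor B Z), u ⊙ e ≃ v ⊙ e -> u ≃ v.

Definition kernel (C : zero_category) (A B K : C) (f : mor A B) (k : mor K A) :
    Prop :=
  zero (f ⊙ k) /\
  (forall (Z : C) (z : mor Z A), zero (f ⊙ z) ->
     exists u : mor Z K, k ⊙ u ≃ z) /\
  monic k.

Definition cokernel (C : zero_category) (A B Q : C) (f : mor A B)
    (c : mor B Q) : Prop :=
  zero (c ⊙ f) /\
  (forall (Z : C) (z : mor B Z), zero (z ⊙ f) ->
     exists u : mor Q Z, u ⊙ c ≃ z) /\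
  epic c.

Definition normal_mono (C : zero_category) (A B : C) (m : mor A B) : Prop :=
  exists (D : C) (f : mor B D), kernel f m.

Definition normal_epi (C : zero_category) (A B : C) (e : mor A B) : Prop :=
  exists (D : C) (f : mor D A), cokernel f e.

(** [m] is an image and [e] a coimage of [f]. *)
Definition factorisation (C : zero_category) (A I B : C) (f : mor A B)
    (m : mor I B) (e : mor A I) : Prop :=
  normal_mono m /\ normal_epi e /\ f ≃ m ⊙ e.

Definition normal_mor (C : zero_category) (A B : C) (f : mor A B) : Prop :=
  exists (I : C) (m : mor I B) (e : mor A I), factorisation f m e.

(** The image of [f] is a kernel of [g]. *)
Definition exact_at (C : zero_category) (A B D : C) (f : mor A B)
    (g : mor B D) : Prop :=
  exists (I : C) (m : mor I B) (e : mor A I), factorisation f m e /\ kernel g m.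

(** A category with zero morphisms which has kernels and cokernels, and in which
    a normal monomorphism followed by a normal epimorphism is normal. *)
Record di_exact (C : zero_category) : Prop := {
  kernel_exists : forall (A B : C) (f : mor A B),
    exists (K : C) (k : mor K A), kernel f k;
  cokernel_exists : forall (A B : C) (f : mor A B),
    exists (Q : C) (c : mor B Q), cokernel f c;
  antinormal_normal : forall (A B D : C) (m : mor A B) (e : mor B D),
    normal_mono m -> normal_epi e -> normal_mor (e ⊙ m)
}.

Lemma factorisation_opposite (C : zero_category) (A I B : C) (f : mor A B)
    (m : mor I B) (e : mor A I) :
  factorisation f m e -> @factorisation (opposite C) B I A f e m.
Proof. intros [Hm [He H]]. exact (conj He (conj Hm H)). Qed.

Lemma normal_opposite (C : zero_category) (A B : C) (f : mor A B) :
  normal_mor f -> @normal_mor (opposite C) B A f.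
Proof.
  intros [I [m [e H]]]. exists I, e, m. now apply factorisation_opposite.
Qed.

Lemma di_exact_opposite (C : zero_category) : di_exact C -> di_exact (opposite C).
Proof.
  intros [HK HC HD]; split.
  - intros A B f. exact (HC B A f).
  - intros A B f. exact (HK B A f).
  - intros A B D m e Hm He. apply normal_opposite. exact (HD D B A e m He Hm).
Qed.

Lemma kernel_monic (C : zero_category) (A B K : C) (f : mor A B) (k : mor K A) :
  kernel f k -> monic k.
Proof. intros H; apply H. Qed.

Lemma normal_mono_monic (C : zero_category) (A B : C) (m : mor A B) :
  normal_mono m -> monic m.
Proof. intros [D [f H]]; apply H. Qed.

Lemma normal_epi_epic (C : zero_category) (A B : C) (e : mor A B) :
  normal_epi e -> epic e.
Proof. intros [D [f H]]; apply H. Qed.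

Lemma monic_zero (C : zero_category) (A B Z : C) (m : mor A B) (u : mor Z A) :
  monic m -> zero (m ⊙ u) -> zero u.
Proof.
  intros Hm H. destruct (zero_exists Z A) as [z Hz].
  rewrite (Hm Z u z); [exact Hz |].
  apply zero_unique; [exact H | now apply zero_compr].
Qed.

Lemma epic_zero (C : zero_category) (A B Z : C) (e : mor A B) (u : mor B Z) :
  epic e -> zero (u ⊙ e) -> zero u.
Proof. exact (@monic_zero (opposite C) B A Z e u). Qed.

Lemma kernel_monic_comp (C : zero_category) (A B D K : C) (f : mor A B)
    (m : mor B D) (h : mor A D) (k : mor K A) :
  monic m -> h ≃ m ⊙ f -> (kernel h k <-> kernel f k).
Proof.
  intros Hm E.
  assert (Z : forall (T : C) (z : mor T A), zero (h ⊙ z) <-> zero (f ⊙ z)).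
  { intros T z. rewrite E, compA. split.
    - now apply monic_zero.
    - now apply zero_compr. }
  split; intros [H1 [H2 H3]]; (split; [now apply Z | split; [|exact H3]]);
    intros T z Hz; now apply H2, Z.
Qed.

Lemma cokernel_epic_comp (C : zero_category) (A B D Q : C) (f : mor A B)
    (e : mor D A) (h : mor D B) (q : mor B Q) :
  epic e -> h ≃ f ⊙ e -> (cokernel h q <-> cokernel f q).
Proof. exact (@kernel_monic_comp (opposite C) B A D Q f e h q). Qed.

Lemma kernel_eqv (C : zero_category) (A B K : C) (f f' : mor A B)
    (k k' : mor K A) :
  f ≃ f' -> k ≃ k' -> kernel f k -> kernel f' k'.
Proof.
  intros Ef Ek [H1 [H2 H3]]. split; [| split].
  - now rewrite <- Ef, <- Ek.
  - intros Z z Hz. rewrite <- Ef in Hz. destruct (H2 Z z Hz) as [u Hu].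
    exists u. now rewrite <- Ek.
  - intros Z u v. rewrite <- Ek. apply H3.
Qed.

Lemma cokernel_eqv (C : zero_category) (A B Q : C) (f f' : mor A B)
    (q q' : mor B Q) :
  f ≃ f' -> q ≃ q' -> cokernel f q -> cokernel f' q'.
Proof. exact (@kernel_eqv (opposite C) B A Q f f' q q'). Qed.

Definition inverse_mor (C : zero_category) (A B : C) (s : mor A B)
    (t : mor B A) : Prop :=
  s ⊙ t ≃ idm B /\ t ⊙ s ≃ idm A.

Lemma kernel_iso (C : zero_category) (A B K K' : C) (f : mor A B)
    (k : mor K A) (s : mor K' K) (t : mor K K') :
  inverse_mor s t -> kernel f k -> kernel f (k ⊙ s).
Proof.
  intros [st ts] [H1 [H2 H3]]. split; [| split].
  - rewrite <- compA. now apply zero_compl.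
  - intros Z z Hz. destruct (H2 Z z Hz) as [u Hu]. exists (t ⊙ u).
    now rewrite compA, (comp_eqv_assoc st), comp_idl.
  - intros Z u v H. rewrite !compA in H. apply H3 in H.
    rewrite <- (comp_idl u), <- (comp_idl v), <- ts, !compA.
    now rewrite H.
Qed.

Lemma cokernel_iso (C : zero_category) (A B Q Q' : C) (f : mor A B)
    (q : mor B Q) (s : mor Q Q') (t : mor Q' Q) :
  inverse_mor s t -> cokernel f q -> cokernel f (s ⊙ q).
Proof.
  intros [st ts]. exact (@kernel_iso (opposite C) B A Q Q' f q s t (conj ts st)).
Qed.

Lemma kernel_unique (C : zero_category) (A B K K' : C) (f : mor A B)
    (k : mor K A) (k' : mor K' A) :
  kernel f k -> kernel f k' ->
  exists (s : mor K K') (t : mor K' K), inverse_mor s t /\ k' ⊙ s ≃ k.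
Proof.
  intros [H1 [H2 H3]] [H1' [H2' H3']].
  destruct (H2' K k H1) as [s Hs]. destruct (H2 K' k' H1') as [t Ht].
  exists s, t. split; [split |exact Hs].
  - apply H3'. now rewrite (comp_eqv_assoc Hs), Ht, comp_idr.
  - apply H3. now rewrite (comp_eqv_assoc Ht), Hs, comp_idr.
Qed.

Lemma cokernel_unique (C : zero_category) (A B Q Q' : C) (f : mor A B)
    (q : mor B Q) (q' : mor B Q') :
  cokernel f q -> cokernel f q' ->
  exists (s : mor Q Q') (t : mor Q' Q), inverse_mor s t /\ s ⊙ q ≃ q'.
Proof.
  intros H H'.
  destruct (@kernel_unique (opposite C) B A Q' Q f q' q H' H) as [s [t [I E]]].
  exists s, t. split; [split; apply I | exact E].
Qed.

Lemma normal_mono_kernel_cokernel (C : zero_category) (A B Q : C) (m : mor A B)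
    (c : mor B Q) :
  normal_mono m -> cokernel m c -> kernel c m.
Proof.
  intros [D [f [H1 [H2 H3]]]] [Hc [Hu _]]. split; [exact Hc | split; [|exact H3]].
  intros Z z Hz. apply H2. destruct (Hu D f H1) as [v Hv].
  rewrite <- Hv, compA. now apply zero_compr.
Qed.

Lemma normal_epi_cokernel_kernel (C : zero_category) (A B K : C) (e : mor A B)
    (k : mor K A) :
  normal_epi e -> kernel e k -> cokernel k e.
Proof. exact (@normal_mono_kernel_cokernel (opposite C) B A K e k). Qed.

Lemma factorisation_kernel (C : zero_category) (A I B Q : C) (f : mor A B)
    (m : mor I B) (e : mor A I) (c : mor B Q) :
  factorisation f m e -> cokernel f c -> kernel c m.
Proof.
  intros [Hm [He E]] Hc. apply normal_mono_kernel_cokernel; [exact Hm |].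
  now apply (cokernel_epic_comp c (normal_epi_epic He) E).
Qed.

Lemma factorisation_cokernel (C : zero_category) (A I B K : C) (f : mor A B)
    (m : mor I B) (e : mor A I) (k : mor K A) :
  factorisation f m e -> kernel f k -> cokernel k e.
Proof.
  intros H. apply (@factorisation_kernel (opposite C) B I A K f e m k).
  now apply factorisation_opposite.
Qed.

(** * Kernels and cokernels of a morphism between two short sequences *)

(** The coimage of [f] is [e1 ⊙ e] for some [e1], which is a cokernel of the
    antinormal [e ⊙ k].  Hence the image of [e ⊙ k] is a kernel of [e1], and
    [e1] has the same kernel as [f1]. *)
Lemma kernel_image_normal_epi (C : zero_category) (HC : di_exact C)
    (A I X K K1 : C) (f : mor A X) (f1 : mor I X) (e : mor A I)
    (k : mor K A) (k1 : mor K1 I) :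
  normal_mor f -> normal_epi e -> f ≃ f1 ⊙ e -> kernel f k -> kernel f1 k1 ->
  exists e' : mor K K1, normal_epi e' /\ e ⊙ k ≃ k1 ⊙ e'.
Proof.
  intros [J [mf [ef Hf]]] He E Hk Hk1.
  destruct (kernel_exists HC e) as [N [n Hn]].
  pose proof (normal_epi_cokernel_kernel He Hn) as Hen.
  pose proof (normal_epi_epic He) as Hee.
  pose proof (factorisation_cokernel Hf Hk) as Hef.
  destruct Hf as [Hmf [Hef' Ef]].
  pose proof (normal_mono_monic Hmf) as Mmf.
  assert (Z : zero (ef ⊙ n)).
  { apply (monic_zero Mmf). rewrite <- compA, <- Ef, E, compA.
    apply zero_compr, Hn. }
  destruct (proj1 (proj2 Hen) J ef Z) as [e1 He1].
  assert (E1 : f1 ≃ mf ⊙ e1).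
  { apply Hee. now rewrite compA, He1, <- Ef. }
  assert (Hc : cokernel (e ⊙ k) e1).
  { split; [| split].
    - rewrite <- compA, He1. apply Hef.
    - intros T z Hz. rewrite <- compA in Hz.
      destruct (proj1 (proj2 Hef) T _ Hz) as [y Hy]. exists y.
      apply Hee. now rewrite compA, He1.
    - intros T u v H. apply (proj2 (proj2 Hef)).
      now rewrite <- He1, <- !compA, H. }
  assert (Nk : normal_mono k) by (now exists X, f).
  destruct (antinormal_normal HC Nk He) as [I' [m' [e' H']]].
  pose proof (factorisation_kernel H' Hc) as Hm'.
  apply (kernel_monic_comp k1 Mmf E1) in Hk1.
  destruct (kernel_unique Hm' Hk1) as [s [t [Hst Es]]].
  exists (s ⊙ e'). destruct H' as [_ [[D [w Hw]] E']]. split.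
  - exists D, w. exact (cokernel_iso Hst Hw).
  - now rewrite (comp_eqv_assoc Es).
Qed.

Lemma induced_on_kernels (C : zero_category) (A B X Y Kf Kg : C)
    (a : mor A B) (c : mor X Y) (f : mor A X) (g : mor B Y)
    (kf : mor Kf A) (kg : mor Kg B) :
  g ⊙ a ≃ c ⊙ f -> kernel f kf -> kernel g kg ->
  exists a' : mor Kf Kg, kg ⊙ a' ≃ a ⊙ kf.
Proof.
  intros phi Hf Hg. apply (proj1 (proj2 Hg)).
  rewrite <- compA, phi, compA. apply zero_compr, Hf.
Qed.

Lemma induced_on_cokernels (C : zero_category) (A B X Y Cf Cg : C)
    (a : mor A B) (c : mor X Y) (f : mor A X) (g : mor B Y)
    (cf : mor X Cf) (cg : mor Y Cg) :
  g ⊙ a ≃ c ⊙ f -> cokernel f cf -> cokernel g cg ->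
  exists c' : mor Cf Cg, c' ⊙ cf ≃ cg ⊙ c.
Proof.
  intros phi Hf Hg. apply (proj1 (proj2 Hf)).
  rewrite compA, <- phi, <- compA. apply zero_compl, Hg.
Qed.

(** Forming kernels of the vertical morphisms preserves a kernel in the row.  Of
    the third vertical morphism only the monomorphism [kh] is needed, and [c]
    need only be a monomorphism. *)
Lemma induced_kernel (C : zero_category) (A B D X Y Kf Kg Kh : C)
    (a : mor A B) (b : mor B D) (c : mor X Y) (f : mor A X) (g : mor B Y)
    (kf : mor Kf A) (kg : mor Kg B) (kh : mor Kh D)
    (a' : mor Kf Kg) (b' : mor Kg Kh) :
  kernel b a -> monic c -> g ⊙ a ≃ c ⊙ f -> kernel f kf -> kernel g kg ->
  monic kh -> kg ⊙ a' ≃ a ⊙ kf -> kh ⊙ b' ≃ b ⊙ kg -> kernel b' a'.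
Proof.
  intros Ha Hc phi Hf Hg Hh Ea Eb. split; [| split].
  - apply (monic_zero Hh). rewrite (comp_eqv_assoc Eb), compA, Ea, <- compA.
    apply zero_compl, Ha.
  - intros Z z Hz.
    assert (Z1 : zero (b ⊙ (kg ⊙ z))).
    { rewrite <- compA, <- Eb, compA. now apply zero_compr. }
    destruct (proj1 (proj2 Ha) Z _ Z1) as [w Hw].
    assert (Z2 : zero (f ⊙ w)).
    { apply (monic_zero Hc).
      rewrite <- compA, <- phi, compA, Hw, <- compA. apply zero_compl, Hg. }
    destruct (proj1 (proj2 Hf) Z _ Z2) as [v Hv].
    exists v. apply (kernel_monic Hg).
    now rewrite (comp_eqv_assoc Ea), compA, Hv.
  - intros Z u v H. apply (kernel_monic Hf), (kernel_monic Ha).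
    now rewrite <- !compA, <- Ea, !compA, H.
Qed.

Lemma induced_cokernel (C : zero_category) (B D X Y Z Cf Cg Ch : C)
    (b : mor B D) (c : mor X Y) (d : mor Y Z) (g : mor B Y) (h : mor D Z)
    (cf : mor X Cf) (cg : mor Y Cg) (ch : mor Z Ch)
    (c' : mor Cf Cg) (d' : mor Cg Ch) :
  cokernel c d -> epic b -> h ⊙ b ≃ d ⊙ g -> cokernel h ch -> cokernel g cg ->
  epic cf -> c' ⊙ cf ≃ cg ⊙ c -> d' ⊙ cg ≃ ch ⊙ d -> cokernel c' d'.
Proof.
  intros Hd Hb psi Hch Hcg Hcf Ec Ed.
  exact (@induced_kernel (opposite C) Z Y X D B Ch Cg Cf d c b h g ch cg cf d' c'
    Hd Hb (symmetry psi) Hch Hcg Hcf Ed Ec).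
Qed.

(** With [a = m ⊙ e] the normal factorisation and [f = f1 ⊙ e], the morphism
    [a'] is the normal epimorphism [Kf → Ker f1] followed by the kernel
    [Ker f1 → Kg] of [b']. *)
Lemma exact_at_kernels (C : zero_category) (HC : di_exact C)
    (A B D X Y Z Kf Kg Kh : C)
    (a : mor A B) (b : mor B D) (c : mor X Y) (d : mor Y Z)
    (f : mor A X) (g : mor B Y) (h : mor D Z)
    (kf : mor Kf A) (kg : mor Kg B) (kh : mor Kh D)
    (a' : mor Kf Kg) (b' : mor Kg Kh) :
  normal_mor a -> cokernel a b -> kernel d c ->
  g ⊙ a ≃ c ⊙ f -> h ⊙ b ≃ d ⊙ g -> normal_mor f ->
  kernel f kf -> kernel g kg -> monic kh ->
  kg ⊙ a' ≃ a ⊙ kf -> kh ⊙ b' ≃ b ⊙ kg ->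
  exact_at a' b'.
Proof.
  intros [I [m [e Ha]]] Hab Hcd phi psi Nf Hf Hg Hh Ea Eb.
  pose proof (factorisation_kernel Ha Hab) as Hm.
  destruct Ha as [_ [He E]].
  assert (Z0 : zero (d ⊙ (g ⊙ m))).
  { rewrite <- compA, <- psi, compA. apply zero_compr, Hm. }
  destruct (proj1 (proj2 Hcd) I _ Z0) as [f1 Hf1].
  assert (E1 : f ≃ f1 ⊙ e).
  { apply (kernel_monic Hcd). now rewrite (comp_eqv_assoc Hf1), compA, <- E. }
  destruct (kernel_exists HC f1) as [K1 [k1 Hk1]].
  destruct (kernel_image_normal_epi HC Nf He E1 Hf Hk1) as [e' [He' Ee']].
  assert (Z1 : zero (g ⊙ (m ⊙ k1))).
  { rewrite <- compA, <- Hf1, compA. apply zero_compr, Hk1. }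
  destruct (proj1 (proj2 Hg) K1 _ Z1) as [a1 Ha1].
  assert (Hk : kernel b' a1).
  { eapply induced_kernel with (f := f1); eauto using kernel_monic.
    now symmetry. }
  exists K1, a1, e'. split; [| exact Hk].
  split; [now exists Kh, b' | split; [exact He' |]].
  apply (kernel_monic Hg).
  now rewrite Ea, E, compA, Ee', (comp_eqv_assoc Ha1), compA.
Qed.

(** The antinormal [b ⊙ kg] is normal, and its image factors through [kh]. *)
Lemma induced_normal (C : zero_category) (HC : di_exact C)
    (B D Y Z Kg Kh : C) (b : mor B D) (g : mor B Y) (h : mor D Z)
    (kg : mor Kg B) (kh : mor Kh D) (b' : mor Kg Kh) :
  normal_epi b -> kernel g kg -> kernel h kh -> kh ⊙ b' ≃ b ⊙ kg ->
  normal_mor b'.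
Proof.
  intros Hb Hg Hh E.
  assert (Nk : normal_mono kg) by (now exists Y, g).
  destruct (antinormal_normal HC Nk Hb) as [I [m [e [[V [w Hw]] [He Ee]]]]].
  assert (Z0 : zero (h ⊙ m)).
  { apply (epic_zero (normal_epi_epic He)).
    rewrite compA, <- Ee, <- E, <- compA. apply zero_compl, Hh. }
  destruct (proj1 (proj2 Hh) I m Z0) as [m' Hm'].
  exists I, m', e. split; [| split; [exact He |]].
  - exists V, (w ⊙ kh). split; [| split].
    + rewrite compA, Hm'. apply Hw.
    + intros T z Hz. rewrite compA in Hz.
      destruct (proj1 (proj2 Hw) T _ Hz) as [u Hu]. exists u.
      apply (kernel_monic Hh). now rewrite (comp_eqv_assoc Hm').
    + intros T u v H. apply (kernel_monic Hw).
      now rewrite <- Hm', !compA, H.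
  - apply (kernel_monic Hh). now rewrite E, Ee, (comp_eqv_assoc Hm').
Qed.

(** If [m] is the kernel of [q], then [n] is the pullback of [m] along [c], and
    [x] is the pullback of [c] along [m].  As [c] is the kernel of [d], [x] is
    the kernel of [d ⊙ m]. *)
Lemma kernel_pullback (C : zero_category) (X Y Z G Q N : C)
    (c : mor X Y) (d : mor Y Z) (m : mor G Y) (q : mor Y Q)
    (n : mor N X) (x : mor N G) :
  kernel d c -> kernel q m -> kernel (q ⊙ c) n -> c ⊙ n ≃ m ⊙ x ->
  kernel (d ⊙ m) x.
Proof.
  intros Hc Hm Hn E. split; [| split].
  - rewrite compA, <- E, <- compA. apply zero_compl, Hc.
  - intros T z Hz. rewrite compA in Hz.
    destruct (proj1 (proj2 Hc) T _ Hz) as [w Hw].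
    assert (Z0 : zero ((q ⊙ c) ⊙ w)).
    { rewrite compA, Hw, <- compA. apply zero_compl, Hm. }
    destruct (proj1 (proj2 Hn) T _ Z0) as [v Hv]. exists v.
    apply (kernel_monic Hm). now rewrite <- compA, <- E, compA, Hv.
  - intros T u v H. apply (kernel_monic Hn), (kernel_monic Hc).
    now rewrite <- !compA, E, !compA, H.
Qed.

Lemma cokernel_pushout (C : zero_category) (A B D G K M : C)
    (a : mor A B) (b : mor B D) (e : mor B G) (k : mor K B)
    (mu : mor D M) (y : mor G M) :
  cokernel a b -> cokernel k e -> cokernel (b ⊙ k) mu -> mu ⊙ b ≃ y ⊙ e ->
  cokernel (e ⊙ a) y.
Proof. exact (@kernel_pullback (opposite C) D B A G K M b a e k mu y). Qed.

(** * The connecting morphism *)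

(** Here [mg] and [eg] are the image and coimage of [g], [N] is the
    intersection of [X] and [G] in [Y], and [y] is the quotient of [G] by the
    image of [A].  The image [W] of [y ⊙ x] is a kernel of [c'].  Indeed both
    [N → W] and the normal epimorphism [N → Ker c'] through which [cf ⊙ n]
    factors are cokernels of their kernels, and these kernels agree. *)
Lemma kernel_induced_cokernels (C : zero_category) (HC : di_exact C)
    (A B X Y Z G Cf Cg N M W : C)
    (a : mor A B) (c : mor X Y) (d : mor Y Z) (f : mor A X) (g : mor B Y)
    (cf : mor X Cf) (cg : mor Y Cg) (c' : mor Cf Cg)
    (mg : mor G Y) (eg : mor B G) (n : mor N X) (x : mor N G) (y : mor G M)
    (mw : mor W M) (ew : mor N W) :
  normal_mor a -> zero ((d ⊙ g) ⊙ a) -> kernel d c -> g ⊙ a ≃ c ⊙ f ->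
  normal_mor f -> cokernel f cf -> cokernel g cg -> c' ⊙ cf ≃ cg ⊙ c ->
  factorisation g mg eg -> kernel (cg ⊙ c) n -> c ⊙ n ≃ mg ⊙ x ->
  cokernel (eg ⊙ a) y -> factorisation (y ⊙ x) mw ew ->
  exists kc : mor W Cf, kernel c' kc.
Proof.
  intros [I [ma [ea [Hma [Hea Ea]]]]] Z0 Hc phi [J [mf [ef Hf]]] Hcf Hcg Ec Hg
    Hn Enx Hy Hw.
  pose proof (normal_epi_epic Hea) as Eea.
  pose proof (kernel_monic Hc) as Mc.
  pose proof (factorisation_kernel Hg Hcg) as Hmg.
  pose proof (kernel_monic Hmg) as Mmg.
  pose proof (factorisation_kernel Hf Hcf) as Hmf.
  assert (Neg : normal_epi eg) by apply Hg.
  assert (Eg : g ≃ mg ⊙ eg) by apply Hg.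
  assert (Eef : epic ef) by (apply normal_epi_epic, Hf).
  assert (Ef : f ≃ mf ⊙ ef) by apply Hf.
  assert (Ncf : normal_epi cf) by (now exists A, f).
  assert (Nc : normal_mono c) by (now exists Z, d).
  assert (Ncg : normal_epi cg) by (now exists B, g).
  (* [my], the image of [eg ⊙ ma], is the kernel of [y] *)
  destruct (antinormal_normal HC Hma Neg) as [F [my [ey Hey]]].
  assert (Hy' : cokernel (eg ⊙ ma) y).
  { apply (cokernel_epic_comp (h := eg ⊙ a) y Eea); [| exact Hy].
    now rewrite Ea, compA. }
  pose proof (factorisation_kernel Hey Hy') as Hmy.
  destruct Hey as [_ [Ney Ey]].
  pose proof (normal_epi_epic Ney) as Eey.
  (* [S1] and [S2]: composed with [c] and [mg], the monomorphisms [mf] and [my]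
     become the same subobject of [Y] *)
  assert (S1 : exists s : mor J F, c ⊙ mf ≃ mg ⊙ (my ⊙ s)).
  { assert (Z1 : zero (cg ⊙ (c ⊙ mf))).
    { apply (epic_zero Eef). rewrite !compA, <- Ef, <- phi, <- compA.
      apply zero_compl, Hcg. }
    destruct (proj1 (proj2 Hmg) J _ Z1) as [s Hs].
    assert (Z2 : zero (y ⊙ s)).
    { apply (epic_zero Eef). rewrite compA.
      assert (E : s ⊙ ef ≃ eg ⊙ a).
      { apply Mmg. now rewrite (comp_eqv_assoc Hs), compA, <- Ef, <- phi, Eg, compA. }
      rewrite E. apply Hy. }
    destruct (proj1 (proj2 Hmy) J _ Z2) as [s' Hs']. exists s'.
    now rewrite Hs', Hs. }
  assert (S2 : exists r : mor F J, mg ⊙ my ≃ c ⊙ (mf ⊙ r)).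
  { assert (E : mg ⊙ (my ⊙ (ey ⊙ ea)) ≃ g ⊙ a).
    { now rewrite (comp_eqv_assoc (symmetry Ey)), compA, <- Ea, <- compA, <- Eg. }
    assert (Z1 : zero (d ⊙ (mg ⊙ my))).
    { apply (epic_zero Eey), (epic_zero Eea). rewrite !compA, E, <- compA.
      exact Z0. }
    destruct (proj1 (proj2 Hc) F _ Z1) as [r Hr].
    assert (Z2 : zero (cf ⊙ r)).
    { apply (epic_zero Eey), (epic_zero Eea). rewrite !compA.
      assert (E' : r ⊙ (ey ⊙ ea) ≃ f).
      { apply Mc. now rewrite (comp_eqv_assoc Hr), compA, E. }
      rewrite E'. apply Hcf. }
    destruct (proj1 (proj2 Hmf) F _ Z2) as [r' Hr']. exists r'.
    now rewrite Hr', Hr. }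
  destruct S1 as [s Hs], S2 as [r Hr].
  destruct (kernel_exists HC c') as [K1 [k1 Hk1]].
  destruct (kernel_image_normal_epi HC (antinormal_normal HC Nc Ncg) Ncf
    (symmetry Ec) Hn Hk1) as [ek [Hek Ek]].
  destruct (kernel_exists HC (y ⊙ x)) as [U [j Hj]].
  pose proof (factorisation_cokernel Hw Hj) as Hew.
  assert (S3 : forall (T : C) (t : mor T N), zero (ek ⊙ t) <-> zero ((y ⊙ x) ⊙ t)).
  { intros T t. split; intros H.
    - assert (Z1 : zero (cf ⊙ (n ⊙ t))).
      { rewrite (comp_eqv_assoc Ek), compA. now apply zero_compr. }
      destruct (proj1 (proj2 Hmf) T _ Z1) as [v Hv].
      assert (E : x ⊙ t ≃ my ⊙ (s ⊙ v)).
      { apply Mmg.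
        now rewrite <- compA, <- Enx, compA, <- Hv, (comp_eqv_assoc Hs), !compA. }
      rewrite compA, E, <- compA. apply zero_compl, Hmy.
    - rewrite compA in H. destruct (proj1 (proj2 Hmy) T _ H) as [v Hv].
      assert (E : n ⊙ t ≃ mf ⊙ (r ⊙ v)).
      { apply Mc.
        now rewrite (comp_eqv_assoc Enx), compA, <- Hv, (comp_eqv_assoc Hr), !compA. }
      apply (monic_zero (kernel_monic Hk1)).
      rewrite <- compA, <- Ek, compA, E, <- compA. apply zero_compl, Hmf. }
  assert (Hjk : kernel ek j).
  { split; [apply S3, Hj | split; [| apply Hj]].
    intros T z Hz. apply Hj, S3, Hz. }
  pose proof (normal_epi_cokernel_kernel Hek Hjk) as Hck.
  destruct (cokernel_unique Hew Hck) as [i [i' [Hi _]]].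
  exists (k1 ⊙ i). exact (kernel_iso Hi Hk1).
Qed.

Lemma cokernel_induced_kernels (C : zero_category) (HC : di_exact C)
    (A B D Y Z G Kg Kh N M W : C)
    (a : mor A B) (b : mor B D) (d : mor Y Z) (g : mor B Y) (h : mor D Z)
    (kg : mor Kg B) (kh : mor Kh D) (b' : mor Kg Kh)
    (mg : mor G Y) (eg : mor B G) (mu : mor D M) (x : mor N G) (y : mor G M)
    (mw : mor W M) (ew : mor N W) :
  normal_mor d -> zero (d ⊙ (g ⊙ a)) -> cokernel a b -> h ⊙ b ≃ d ⊙ g ->
  normal_mor h -> kernel h kh -> kernel g kg -> kh ⊙ b' ≃ b ⊙ kg ->
  factorisation g mg eg -> cokernel (b ⊙ kg) mu -> mu ⊙ b ≃ y ⊙ eg ->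
  kernel (d ⊙ mg) x -> factorisation (y ⊙ x) mw ew ->
  exists qb : mor Kh W, cokernel b' qb.
Proof.
  intros Nd Z0 Hb psi Nh Hkh Hkg Eb Hg Hmu Hy Hx Hw.
  exact (@kernel_induced_cokernels (opposite C) (di_exact_opposite HC)
    Z Y D B A G Kh Kg M N W d b a h g kh kg b' eg mg mu y x ew mw
    (normal_opposite Nd) Z0 Hb (symmetry psi) (normal_opposite Nh) Hkh Hkg Eb
    (factorisation_opposite Hg) Hmu Hy Hx (factorisation_opposite Hw)).
Qed.

(** Exactness is self-dual: the image of [f] is a kernel of [g] as soon as the
    coimage of [g] is a cokernel of [f]. *)
Lemma exact_at_of_opposite (C : zero_category) (A B D : C) (f : mor A B)
    (g : mor B D) :
  normal_mor f -> @exact_at (opposite C) D B A g f -> exact_at f g.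
Proof.
  intros [I [m [e H]]] [J [e' [m' [[He' [Hm' E']] Hk]]]].
  exists I, m, e. split; [exact H |].
  apply (@kernel_monic_comp C B J D I e' m' g m
    (@normal_mono_monic C J D m' Hm') E').
  exact (factorisation_kernel H Hk).
Qed.

(** * The snake lemma in a di-exact category *)

Lemma snake (C : zero_category) (HC : di_exact C)
    (A B D X Y Z Kf Kg Kh Cf Cg Ch : C)
    (a : mor A B) (b : mor B D) (c : mor X Y) (d : mor Y Z)
    (f : mor A X) (g : mor B Y) (h : mor D Z)
    (kf : mor Kf A) (kg : mor Kg B) (kh : mor Kh D)
    (cf : mor X Cf) (cg : mor Y Cg) (ch : mor Z Ch)
    (a' : mor Kf Kg) (b' : mor Kg Kh) (c' : mor Cf Cg) (d' : mor Cg Ch) :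
  normal_mor a -> cokernel a b -> kernel d c -> normal_mor d ->
  g ⊙ a ≃ c ⊙ f -> h ⊙ b ≃ d ⊙ g ->
  normal_mor f -> normal_mor g -> normal_mor h ->
  kernel f kf -> kernel g kg -> kernel h kh ->
  cokernel f cf -> cokernel g cg -> cokernel h ch ->
  kg ⊙ a' ≃ a ⊙ kf -> kh ⊙ b' ≃ b ⊙ kg ->
  c' ⊙ cf ≃ cg ⊙ c -> d' ⊙ cg ≃ ch ⊙ d ->
  exists δ : mor Kh Cf,
    exact_at a' b' /\ exact_at b' δ /\ exact_at δ c' /\ exact_at c' d' /\
    normal_mor d'.
Proof.
  intros Na Hb Hc Nd phi psi Nf Ng Nh Hkf Hkg Hkh Hcf Hcg Hch Ea Eb Ec Ed.
  pose proof (di_exact_opposite HC) as HC'.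
  assert (Nb : normal_epi b) by (now exists A, a).
  assert (Nc : normal_mono c) by (now exists Z, d).
  pose proof (induced_normal HC Nb Hkg Hkh Eb) as Nb'.
  assert (Nc' : normal_mor c').
  { apply (@normal_opposite (opposite C) Cg Cf).
    exact (@induced_normal (opposite C) HC' Y X B A Cg Cf c g f cg cf c'
             Nc Hcg Hcf Ec). }
  pose proof (exact_at_kernels HC Na Hb Hc phi psi Nf Hkf Hkg (kernel_monic Hkh)
    Ea Eb) as X1.
  pose proof (@exact_at_kernels (opposite C) HC' Z Y X D B A Ch Cg Cf
    d c b a h g f ch cg cf d' c' (normal_opposite Nd) Hc Hb
    (symmetry psi) (symmetry phi) (normal_opposite Nh) Hch Hcg
    (proj2 (proj2 Hcf)) Ed Ec) as X4.
  assert (Nd' : normal_mor d').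
  { destruct X4 as [I [m [e [H _]]]]. apply (@normal_opposite (opposite C) Ch Cg).
    now exists I, m, e. }
  apply (exact_at_of_opposite Nc') in X4.
  destruct Ng as [G [mg [eg Hg]]].
  pose proof (factorisation_kernel Hg Hcg) as Hmg.
  pose proof (factorisation_cokernel Hg Hkg) as Heg.
  destruct (kernel_exists HC (cg ⊙ c)) as [N [n Hn]].
  destruct (cokernel_exists HC (b ⊙ kg)) as [M [mu Hmu]].
  assert (Z1 : zero (cg ⊙ (c ⊙ n))) by (rewrite <- compA; apply Hn).
  destruct (proj1 (proj2 Hmg) N _ Z1) as [x Hx].
  assert (Z2 : zero ((mu ⊙ b) ⊙ kg)) by (rewrite compA; apply Hmu).
  destruct (proj1 (proj2 Heg) M _ Z2) as [y Hy].
  symmetry in Hx, Hy.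
  pose proof (kernel_pullback Hc Hmg Hn Hx) as Kx.
  pose proof (cokernel_pushout Hb Heg Hmu Hy) as Ky.
  assert (Nx : normal_mono x) by (now exists Z, (d ⊙ mg)).
  assert (Ny : normal_epi y) by (now exists A, (eg ⊙ a)).
  destruct (antinormal_normal HC Nx Ny) as [W [mw [ew Hw]]].
  assert (Z3 : zero ((d ⊙ g) ⊙ a)).
  { rewrite <- psi, compA. apply zero_compr, Hb. }
  destruct (kernel_induced_cokernels HC Na Z3 Hc phi Nf Hcf Hcg Ec Hg Hn Hx Ky Hw)
    as [kc Hkc].
  assert (Z4 : zero (d ⊙ (g ⊙ a))) by (now rewrite <- compA).
  destruct (cokernel_induced_kernels HC Nd Z4 Hb psi Nh Hkh Hkg Eb Hg Hmu Hy Kx Hw)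
    as [qb Hqb].
  (* [δ] is the composite of the cokernel of [b'] and the kernel of [c'] *)
  exists (kc ⊙ qb).
  pose proof (kernel_monic Hkc) as Mkc.
  split; [exact X1 | split; [| split; [| split; [exact X4 | exact Nd']]]].
  - destruct Nb' as [I [m [e H]]]. exists I, m, e. split; [exact H |].
    apply (kernel_monic_comp (f := qb) (m := kc) m Mkc); [reflexivity |].
    exact (factorisation_kernel H Hqb).
  - exists W, kc, qb. split; [| exact Hkc].
    split; [now exists Cg, c' | split; [now exists Kg, b' | reflexivity]].
Qed.

(** Exactness at [D], where [p] is zero, makes the image of [b] invertible. *)
Lemma cokernel_of_exact (C : zero_category) (A B D T : C)
    (a : mor A B) (b : mor B D) (p : mor D T) :
  exact_at a b -> exact_at b p -> zero p -> cokernel a b.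
Proof.
  intros [I [m [e [Ha Hm]]]] [J [mb [eb [[_ [[V [w Hw]] Eb]] Hmb]]]] Hp.
  assert (Z : zero (p ⊙ idm D)) by (now apply zero_compl).
  destruct (proj1 (proj2 Hmb) D _ Z) as [s Hs].
  assert (Hi : inverse_mor mb s).
  { split; [exact Hs |]. apply (kernel_monic Hmb).
    now rewrite (comp_eqv_assoc Hs), comp_idl, comp_idr. }
  assert (Nb : normal_epi b).
  { exists V, w. apply (cokernel_eqv (f := w) (q := mb ⊙ eb));
      [reflexivity | now symmetry | exact (cokernel_iso Hi Hw)]. }
  destruct Ha as [_ [He E]].
  apply (cokernel_epic_comp b (normal_epi_epic He) E).
  now apply normal_epi_cokernel_kernel.
Qed.

(** Exactness at [X], where [q] is zero, makes the kernel of [c] zero, hence the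
    coimage of [c] invertible. *)
Lemma kernel_of_exact (C : zero_category) (HC : di_exact C) (T X Y Z : C)
    (q : mor T X) (c : mor X Y) (d : mor Y Z) :
  zero q -> exact_at q c -> exact_at c d -> kernel d c.
Proof.
  intros Hq [I [m [e [[_ [He Eq]] Hm]]]] [J [mc [ec [[Hmc [Hec Ec]] Hd]]]].
  assert (Zm : zero m).
  { apply (epic_zero (normal_epi_epic He)). now rewrite <- Eq. }
  destruct (kernel_exists HC ec) as [K [k Hk]].
  pose proof (normal_epi_cokernel_kernel Hec Hk) as Hck.
  assert (Zk : zero k).
  { apply (kernel_monic_comp k (normal_mono_monic Hmc) Ec) in Hk.
    destruct (proj1 (proj2 Hm) K k (proj1 Hk)) as [u Hu].
    rewrite <- Hu. now apply zero_compl. }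
  assert (Z0 : zero (idm X ⊙ k)) by (now apply zero_compr).
  destruct (proj1 (proj2 Hck) X _ Z0) as [s Hs].
  assert (Hi : inverse_mor ec s).
  { split; [| exact Hs]. apply (normal_epi_epic Hec).
    now rewrite compA, Hs, comp_idl, comp_idr. }
  apply (kernel_eqv (f := d) (k := mc ⊙ ec));
    [reflexivity | now symmetry | exact (kernel_iso Hi Hd)].
Qed.

(** * Fully faithful 1-cells *)

Lemma isomorphic_refl (C : Category) (x : C) : x ≅ x.
Proof.
  exists (idar x), (idar x). now rewrite vcomp_idl.
Qed.

Lemma isomorphic_sym (C : Category) (x y : C) : x ≅ y -> y ≅ x.
Proof. intros [s [t [H K]]]. now exists t, s. Qed.

Lemma isomorphic_trans (C : Category) (x y z : C) : x ≅ y -> y ≅ z -> x ≅ z.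
Proof.
  intros [s [t [H K]]] [s' [t' [H' K']]]. exists (s' • s), (t • t'). split.
  - now rewrite vcompA, <- (vcompA t t' s'), H', vcomp_idr.
  - now rewrite vcompA, <- (vcompA s' s t), K, vcomp_idr.
Qed.

#[global] Instance isomorphic_equivalence (C : Category) :
  Equivalence (@isomorphic C).
Proof.
  split; [exact (@isomorphic_refl C) | exact (@isomorphic_sym C)
         | exact (@isomorphic_trans C)].
Qed.

Lemma isomorphic_comp (L : TwoCategory) (A B C : L) (g g' : Hom B C)
    (f f' : Hom A B) :
  g ≅ g' -> f ≅ f' -> g ∘ f ≅ g' ∘ f'.
Proof.
  intros [s [t [H K]]] [s' [t' [H' K']]]. exists (hcomp s s'), (hcomp t t').
  now rewrite <- !interchange, H, K, H', K', !hcomp_id.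
Qed.

Lemma isomorphic_eq (C : Category) (x y : C) : x = y -> x ≅ y.
Proof. intros <-. reflexivity. Qed.

Lemma cast_inj (C : Category) (x x' y y' : C) (p : x = x') (q : y = y')
    (a b : x ⇒ y) :
  cast p q a = cast p q b -> a = b.
Proof. now destruct p, q. Qed.

Lemma cast_surj (C : Category) (x x' y y' : C) (p : x = x') (q : y = y')
    (b : x' ⇒ y') :
  exists a : x ⇒ y, cast p q a = b.
Proof. destruct p, q. now exists b. Qed.

(** Reversal of 1-cells; the 2-cells keep their direction. *)
Definition opposite2 (L : TwoCategory) : TwoCategory.
Proof.
refine {|
  cell0 := L;
  Hom := fun A B => Hom B A;
  id1 := fun A => id1 A;
  comp1 := fun A B C g f => f ∘ g;
  hcomp := fun A B C g g' f f' b a => hcomp a b;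
  comp1A := fun A B C D h g f => eq_sym (comp1A f g h);
  comp1_idl := fun A B f => comp1_idr f;
  comp1_idr := fun A B f => comp1_idl f |}.
- intros A B C g f. apply hcomp_id.
- intros A B C g g' g'' f f' f'' b' b a' a. apply interchange.
- intros A B C D h h' g g' f f' c b a. rewrite <- (hcompA a b c).
  now destruct (comp1A f g h), (comp1A f' g' h').
- intros A B f f' a. apply hcomp_idr.
- intros A B f f' a. apply hcomp_idl.
Defined.

(** Faithfulness and full faithfulness are those of the functors
    [Hom Z A → Hom Z B] given by composition with [k]. *)
Definition faithful (L : TwoCategory) (A B : L) (k : Hom A B) : Prop :=
  forall (Z : L) (u v : Hom Z A) (m m' : u ⇒ v), k ⋆l m = k ⋆l m' -> m = m'.

Definition fully_faithful (L : TwoCategory) (A B : L) (k : Hom A B) : Prop :=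
  forall (Z : L) (u v : Hom Z A) (l : k ∘ u ⇒ k ∘ v),
    exists! m : u ⇒ v, k ⋆l m = l.

(** The dual condition, on the functors given by precomposition with [q]. *)
Definition cofully_faithful (L : TwoCategory) (A B : L) (q : Hom A B) : Prop :=
  forall (Z : L) (u v : Hom B Z) (l : u ∘ q ⇒ v ∘ q),
    exists! m : u ⇒ v, m ⋆r q = l.

Lemma fully_faithful_faithful (L : TwoCategory) (A B : L) (k : Hom A B) :
  fully_faithful k -> faithful k.
Proof.
  intros H Z u v m m' E. destruct (H Z u v (k ⋆l m')) as [n [_ Hn]].
  rewrite <- (Hn m E). now apply Hn.
Qed.

Lemma whisker_comp (L : TwoCategory) (A B C D : L) (h : Hom C D) (g : Hom B C)
    (f f' : Hom A B) (a : f ⇒ f') :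
  cast (comp1A h g f) (comp1A h g f') (h ⋆l (g ⋆l a)) = (h ∘ g) ⋆l a.
Proof. now rewrite hcompA, hcomp_id. Qed.

Lemma fully_faithful_comp (L : TwoCategory) (A B C : L) (h : Hom B C)
    (g : Hom A B) :
  fully_faithful h -> fully_faithful g -> fully_faithful (h ∘ g).
Proof.
  intros Hh Hg Z u v l.
  destruct (cast_surj (comp1A h g u) (comp1A h g v) l) as [l0 Hl0].
  destruct (Hh _ _ _ l0) as [n [Hn Un]]. destruct (Hg _ _ _ n) as [m [Hm Um]].
  exists m. split.
  - now rewrite <- whisker_comp, Hm, Hn.
  - intros m' Hm'. apply Um. symmetry. apply Un.
    rewrite <- whisker_comp, <- Hl0 in Hm'. exact (cast_inj Hm').
Qed.

Lemma faithful_cancel (L : TwoCategory) (A B C : L) (h : Hom B C)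
    (g : Hom A B) :
  faithful (h ∘ g) -> faithful g.
Proof.
  intros H Z u v m m' E. apply H. now rewrite <- !whisker_comp, E.
Qed.

Lemma fully_faithful_cancel (L : TwoCategory) (A B C : L) (h : Hom B C)
    (g : Hom A B) :
  fully_faithful (h ∘ g) -> faithful h -> fully_faithful g.
Proof.
  intros H Fh Z u v l.
  destruct (H Z u v (cast (comp1A h g u) (comp1A h g v) (h ⋆l l)))
    as [m [Hm Um]].
  exists m. split.
  - rewrite <- whisker_comp in Hm. exact (Fh _ _ _ _ _ (cast_inj Hm)).
  - intros m' Hm'. apply Um. now rewrite <- whisker_comp, Hm'.
Qed.

Lemma fully_faithful_id (L : TwoCategory) (A : L) : fully_faithful (id1 A).
Proof.
  intros Z u v l. exists (cast (comp1_idl u) (comp1_idl v) l). split.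
  - apply (cast_inj (p := comp1_idl u) (q := comp1_idl v)). apply hcomp_idl.
  - intros m <-. apply hcomp_idl.
Qed.

Lemma fully_faithful_iso (L : TwoCategory) (A B : L) (k k' : Hom A B) :
  k ≅ k' -> fully_faithful k -> fully_faithful k'.
Proof.
  intros [s [t [ts st]]] Hk Z u v l.
  (* naturality of whiskering along [s] *)
  assert (N : forall m : u ⇒ v, (k' ⋆l m) • (s ⋆r u) = (s ⋆r v) • (k ⋆l m)).
  { intros m. now rewrite <- !interchange, !vcomp_idl, !vcomp_idr. }
  assert (I : forall w : Hom Z A, (s ⋆r w) • (t ⋆r w) = idar (k' ∘ w)).
  { intros w. now rewrite <- interchange, st, vcomp_idl, hcomp_id. }
  assert (J : forall w : Hom Z A, (t ⋆r w) • (s ⋆r w) = idar (k ∘ w)).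
  { intros w. now rewrite <- interchange, ts, vcomp_idl, hcomp_id. }
  destruct (Hk Z u v ((t ⋆r v) • (l • (s ⋆r u)))) as [m [Hm Um]].
  exists m. split.
  - rewrite <- (vcomp_idr (k' ⋆l m)), <- I, vcompA, N, Hm, vcompA, I, vcomp_idl.
    now rewrite <- vcompA, I, vcomp_idr.
  - intros m' <-. apply Um. now rewrite N, vcompA, J, vcomp_idl.
Qed.

(** Full faithfulness is unaffected by precomposition with an equivalence. *)
Lemma fully_faithful_equivalence (L : TwoCategory) (A B D : L) (k0 : Hom B D)
    (s : Hom A B) (t : Hom B A) (k : Hom A D) :
  s ∘ t ≅ id1 B -> t ∘ s ≅ id1 A -> k0 ∘ s ≅ k ->
  fully_faithful k0 -> fully_faithful k.
Proof.
  intros st ts E H. apply (fully_faithful_iso E).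
  apply fully_faithful_comp; [exact H |].
  apply fully_faithful_cancel with (h := t).
  - exact (fully_faithful_iso (isomorphic_sym ts) (@fully_faithful_id L A)).
  - apply faithful_cancel with (h := s), fully_faithful_faithful.
    exact (fully_faithful_iso (isomorphic_sym st) (@fully_faithful_id L B)).
Qed.

Lemma cofully_faithful_equivalence (L : TwoCategory) (A B D : L)
    (q0 : Hom D B) (s : Hom B A) (t : Hom A B) (q : Hom D A) :
  t ∘ s ≅ id1 B -> s ∘ t ≅ id1 A -> s ∘ q0 ≅ q ->
  cofully_faithful q0 -> cofully_faithful q.
Proof. exact (@fully_faithful_equivalence (opposite2 L) A B D q0 s t q). Qed.

Lemma fully_faithful_monic (L : TwoCategory) (A B Z : L) (k : Hom A B)
    (u v : Hom Z A) :
  fully_faithful k -> k ∘ u ≅ k ∘ v -> u ≅ v.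
Proof.
  intros H [l [l' [E E']]].
  destruct (H _ _ _ l) as [m [Hm _]], (H _ _ _ l') as [m' [Hm' _]].
  assert (D : forall (x y z : Hom Z A) (n' : y ⇒ z) (n : x ⇒ y),
      k ⋆l (n' • n) = (k ⋆l n') • (k ⋆l n)).
  { intros x y z n' n. now rewrite <- interchange, vcomp_idl. }
  exists m, m'.
  split; apply (fully_faithful_faithful H); now rewrite D, Hm, Hm', hcomp_id.
Qed.

Lemma cofully_faithful_epic (L : TwoCategory) (A B Z : L) (q : Hom A B)
    (u v : Hom B Z) :
  cofully_faithful q -> u ∘ q ≅ v ∘ q -> u ≅ v.
Proof. exact (@fully_faithful_monic (opposite2 L) B A Z q u v). Qed.

(** * The homotopy category *)

Lemma iso_null_unique (L : TwoCategory) (O : L) (HO : strong_bizero O)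
    (A B : L) (f g : Hom A B) :
  iso_null O f -> iso_null O g -> f ≅ g.
Proof.
  intros [n [Hn En]] [n' [Hn' En']]. rewrite En, En'.
  destruct HO as [_ HO].
  destruct (HO A B n n' Hn Hn') as [s _]. destruct (HO A B n' n Hn' Hn) as [t _].
  exists s, t. split.
  - destruct (HO A B n n Hn Hn) as [w [_ Hw]].
    transitivity w; [symmetry |]; now apply Hw.
  - destruct (HO A B n' n' Hn' Hn') as [w [_ Hw]].
    transitivity w; [symmetry |]; now apply Hw.
Qed.

(** The objects of [L], with 1-cells up to isomorphism; the zero morphisms are
    the 1-cells isomorphic to a null 1-cell. *)
Definition homotopy_category (L : TwoCategory) (O : L) (HO : strong_bizero O) :
  zero_category.
Proof.
refine {|
  ob := L;
  mor := fun A B => Hom A B;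
  eqv := fun A B f g => f ≅ g;
  idm := fun A => id1 A;
  comp := fun A B C g f => g ∘ f;
  zero := fun A B f => iso_null O f |}.
- intros A B C g g' f f'. apply isomorphic_comp.
- intros A B C D h g f. symmetry. apply isomorphic_eq, comp1A.
- intros A B f. apply isomorphic_eq, comp1_idl.
- intros A B f. apply isomorphic_eq, comp1_idr.
- intros A B f g E [n [Hn En]]. exists n. split; [exact Hn |].
  now rewrite <- E.
- intros A B f g. exact (iso_null_unique HO (f := f) (g := g)).
- intros A B. destruct (proj1 HO A) as [[_ [G _]] _].
  destruct (proj1 HO B) as [_ [_ [G' _]]].
  exists (G' tt ∘ G tt), (G' tt ∘ G tt). split; [| reflexivity].
  now exists (G tt), (G' tt).
- intros A B C g f [n [[p [q Hn]] En]]. exists (n ∘ f). split.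
  + exists (p ∘ f), q. now rewrite Hn, comp1A.
  + now apply isomorphic_comp.
- intros A B C g f [n [[p [q Hn]] En]]. exists (g ∘ n). split.
  + exists p, (g ∘ q). now rewrite Hn, comp1A.
  + now apply isomorphic_comp.
Defined.

Lemma kernel_of_2kernel (L : TwoCategory) (O : L) (HO : strong_bizero O)
    (A B K : L) (f : Hom A B) (k : Hom K A) :
  is_2kernel O f k -> @kernel (homotopy_category HO) A B K f k.
Proof.
  intros [H1 [H2 H3]]. split; [exact H1 | split; [exact H2 |]].
  intros Z u v. exact (fully_faithful_monic H3).
Qed.

Lemma cokernel_of_2cokernel (L : TwoCategory) (O : L) (HO : strong_bizero O)
    (A B Q : L) (f : Hom A B) (q : Hom B Q) :
  is_2cokernel O f q -> @cokernel (homotopy_category HO) A B Q f q.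
Proof.
  intros [H1 [H2 H3]]. split; [exact H1 | split; [exact H2 |]].
  intros Z u v. exact (cofully_faithful_epic H3).
Qed.

(** A kernel in the homotopy category is a 2-kernel composed with an
    equivalence, hence fully faithful. *)
Lemma two_kernel_iff (L : TwoCategory) (O : L) (HL : two_di_exact O)
    (A B K : L) (f : Hom A B) (k : Hom K A) :
  is_2kernel O f k <->
  @kernel (homotopy_category (DI_bizero HL)) A B K f k.
Proof.
  split; [apply kernel_of_2kernel |]. intros Hk.
  destruct (DI1_kernel HL f) as [K0 [k0 H0]].
  destruct (kernel_unique Hk (kernel_of_2kernel (DI_bizero HL) H0))
    as [s [t [[st ts] E]]].
  split; [apply Hk | split; [apply Hk |]].
  exact (fully_faithful_equivalence st ts E (proj2 (proj2 H0))).
Qed.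

Lemma two_cokernel_iff (L : TwoCategory) (O : L) (HL : two_di_exact O)
    (A B Q : L) (f : Hom A B) (q : Hom B Q) :
  is_2cokernel O f q <->
  @cokernel (homotopy_category (DI_bizero HL)) A B Q f q.
Proof.
  split; [apply cokernel_of_2cokernel |]. intros Hq.
  destruct (DI1_cokernel HL f) as [Q0 [q0 H0]].
  destruct (cokernel_unique (cokernel_of_2cokernel (DI_bizero HL) H0) Hq)
    as [s [t [[st ts] E]]].
  split; [apply Hq | split; [apply Hq |]].
  exact (cofully_faithful_equivalence ts st E (proj2 (proj2 H0))).
Qed.

Lemma factorisation_iff (L : TwoCategory) (O : L) (HL : two_di_exact O)
    (A I B : L) (f : Hom A B) (m : Hom I B) (e : Hom A I) :
  normal_factorisation O f m e <->
  @factorisation (homotopy_category (DI_bizero HL)) A I B f m e.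
Proof.
  split; intros [[C [w Hw]] [[D [z Hz]] E]];
    (split; [exists C, w | split; [exists D, z | exact E]]);
    first [now apply (two_kernel_iff HL) | now apply (two_cokernel_iff HL)].
Qed.

Lemma normal_iff (L : TwoCategory) (O : L) (HL : two_di_exact O)
    (A B : L) (f : Hom A B) :
  normal O f <-> @normal_mor (homotopy_category (DI_bizero HL)) A B f.
Proof.
  split; intros [I [m [e H]]]; exists I, m, e; now apply (factorisation_iff HL).
Qed.

Lemma exact_pair_iff (L : TwoCategory) (O : L) (HL : two_di_exact O)
    (A B C : L) (f : Hom A B) (g : Hom B C) :
  exact_pair O f g <->
  @exact_at (homotopy_category (DI_bizero HL)) A B C f g.
Proof.
  split; intros [I [m [e [H Hk]]]]; exists I, m, e;
    (split; [now apply (factorisation_iff HL) | now apply (two_kernel_iff HL)]).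
Qed.

Lemma homotopy_di_exact (L : TwoCategory) (O : L) (HL : two_di_exact O) :
  di_exact (homotopy_category (DI_bizero HL)).
Proof.
  split.
  - intros A B f. destruct (DI1_kernel HL f) as [K [k Hk]].
    exists K, k. now apply (two_kernel_iff HL).
  - intros A B f. destruct (DI1_cokernel HL f) as [Q [q Hq]].
    exists Q, q. now apply (two_cokernel_iff HL).
  - intros A B D m e [V [w Hw]] [U [z Hz]]. apply (normal_iff HL), (DI2 HL).
    exists B, e, m. split; [| split; [| reflexivity]].
    + exists U, z. now apply (two_cokernel_iff HL).
    + exists V, w. now apply (two_kernel_iff HL).
Qed.

Lemma exact_pair_normal (L : TwoCategory) (O : L) (A B C : L) (f : Hom A B)
    (g : Hom B C) :
  exact_pair O f g -> normal O f.
Proof. intros [I [m [e [H _]]]]. now exists I, m, e. Qed.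

(** * The snake lemma in a 2-di-exact 2-category *)

Theorem theorem6p9 (L : TwoCategory) (O : L) (HL : two_di_exact O)
    (A B C X Y Z : L)
    (a : Hom A B) (b : Hom B C) (p : Hom C O)
    (q : Hom O X) (c : Hom X Y) (d : Hom Y Z)
    (f : Hom A X) (g : Hom B Y) (h : Hom C Z)
    (phi : g ∘ a ⇒ c ∘ f) (phi_inv : invertible phi)
    (psi : h ∘ b ⇒ d ∘ g) (psi_inv : invertible psi)
    (f_normal : normal O f) (g_normal : normal O g) (h_normal : normal O h)
    (top_exact : exact_sequence O (a ▷ b ▷ seq_last p))
    (bottom_exact : exact_sequence O (q ▷ c ▷ seq_last d))
    (Kf Kg Kh Cf Cg Ch : L)
    (kf : Hom Kf A) (kg : Hom Kg B) (kh : Hom Kh C)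
    (cf : Hom X Cf) (cg : Hom Y Cg) (ch : Hom Z Ch)
    (kf_ker : is_2kernel O f kf)
    (kg_ker : is_2kernel O g kg)
    (kh_ker : is_2kernel O h kh)
    (cf_coker : is_2cokernel O f cf)
    (cg_coker : is_2cokernel O g cg)
    (ch_coker : is_2cokernel O h ch) :
  (exists (a' : Hom Kf Kg) (b' : Hom Kg Kh) (c' : Hom Cf Cg) (d' : Hom Cg Ch),
      kg ∘ a' ≅ a ∘ kf /\ kh ∘ b' ≅ b ∘ kg /\
      c' ∘ cf ≅ cg ∘ c /\ d' ∘ cg ≅ ch ∘ d) /\
  (forall (a' : Hom Kf Kg) (b' : Hom Kg Kh) (c' : Hom Cf Cg) (d' : Hom Cg Ch),
      kg ∘ a' ≅ a ∘ kf -> kh ∘ b' ≅ b ∘ kg ->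
      c' ∘ cf ≅ cg ∘ c -> d' ∘ cg ≅ ch ∘ d ->
      (exists δ : Hom Kh Cf,
          exact_sequence O (a' ▷ b' ▷ δ ▷ c' ▷ seq_last d')) /\
      (is_2kernel O b a -> is_2kernel O b' a') /\
      (is_2cokernel O c d -> is_2cokernel O c' d')).
Proof.
  pose proof (homotopy_di_exact HL) as HC.
  set (H := homotopy_category (DI_bizero HL)) in *.
  assert (Phi : @eqv H A Y (g ∘ a) (c ∘ f)) by (now exists phi).
  assert (Psi : @eqv H B Z (h ∘ b) (d ∘ g)) by (now exists psi).
  destruct top_exact as [Na [Xab [_ [Xbp _]]]].
  destruct bottom_exact as [_ [Xqc [_ [Xcd Nd]]]].
  cbn in Xab, Xbp, Xqc, Xcd.
  assert (Zp : @zero H C O p).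
  { exists p. split; [| reflexivity]. exists p, (id1 O). now rewrite comp1_idl. }
  assert (Zq : @zero H O X q).
  { exists q. split; [| reflexivity]. exists (id1 O), q. now rewrite comp1_idr. }
  apply (exact_pair_iff HL) in Xab, Xbp, Xqc, Xcd.
  apply (normal_iff HL) in Na, Nd, f_normal, g_normal, h_normal.
  apply (two_kernel_iff HL) in kf_ker, kg_ker, kh_ker.
  apply (two_cokernel_iff HL) in cf_coker, cg_coker, ch_coker.
  pose proof (cokernel_of_exact Xab Xbp Zp) as Hb.
  pose proof (kernel_of_exact HC Zq Xqc Xcd) as Hc.
  split.
  - destruct (@induced_on_kernels H A B X Y Kf Kg a c f g kf kg Phi kf_ker kg_ker)
      as [a' Ea].
    destruct (@induced_on_kernels H B C Y Z Kg Kh b d g h kg kh Psi kg_ker kh_ker)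
      as [b' Eb].
    destruct (@induced_on_cokernels H A B X Y Cf Cg a c f g cf cg Phi cf_coker cg_coker)
      as [c' Ec].
    destruct (@induced_on_cokernels H B C Y Z Cg Ch b d g h cg ch Psi cg_coker ch_coker)
      as [d' Ed].
    now exists a', b', c', d'.
  - intros a' b' c' d' Ea Eb Ec Ed. split; [| split].
    + destruct (@snake H HC A B C X Y Z Kf Kg Kh Cf Cg Ch a b c d f g h
        kf kg kh cf cg ch a' b' c' d')
        as [δ [X1 [X2 [X3 [X4 Nd']]]]]; try assumption.
      exists δ. cbn.
      apply (exact_pair_iff HL) in X1, X2, X3, X4. apply (normal_iff HL) in Nd'.
      repeat split; eauto using exact_pair_normal.
    + intros Ha. apply (two_kernel_iff HL) in Ha. apply (two_kernel_iff HL).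
      exact (@induced_kernel H A B C X Y Kf Kg Kh a b c f g kf kg kh a' b'
        Ha (kernel_monic Hc) Phi kf_ker kg_ker (kernel_monic kh_ker) Ea Eb).
    + intros Hd. apply (two_cokernel_iff HL) in Hd. apply (two_cokernel_iff HL).
      exact (@induced_cokernel H B C X Y Z Cf Cg Ch b c d g h cf cg ch c' d'
        Hd (proj2 (proj2 Hb)) Psi ch_coker cg_coker (proj2 (proj2 cf_coker)) Ec Ed).
Qed.
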